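(* Let $k \geq 3$ and let $a_1,a_2,\ldots,a_{k-1},a_k$ be nonnegative integers such that $a_1 < a_2 <\cdots < a_k$ and $a_k > a_{k-1}+1$. If there exists an index $i$ (with $i\geq 1$) such that $i \leq k-2$, $a_i \geq k-2$, and $a_i+1=a_{i+1}$, then $$\mathcal{G}(a_1+1,a_2+1,\ldots,a_k+1) = \mathcal{G}(a_1,a_2,\ldots,a_k),$$ where $\mathcal{G}$ is the Sprague-Grundy function of the game Max-Welter.
   Context: Max-Welter is played with a finite number of coins on a semi-infinite strip of squares labeled $0,1,2,3,\ldots$ from its left end, each square containing at most one coin. A position with $k$ coins in squares $a_1<a_2<\cdots<a_k$ (nonnegative integers) is denoted $(a_1,a_2,\ldots,a_k)$. Two players move alternately; a move consists of taking the coin in the largest occupied square $a_k$ and moving it to any empty square on its left (jumping over other coins is legal). Only the rightmost coin of the current position may be moved; after a move the coins are re-indexed in increasing order. The player first unable to move loses. The Sprague-Grundy value $\mathcal{G}(p)$ of a position $p$ is defined recursively as the smallest nonnegative integer not equal to $\mathcal{G}(q)$ for any $q$ reachable from $p$ in one move (so a terminal position has value $0$). *)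

(* Defs.v *)
From mathcomp Require Import all_boot.

Set Implicit Arguments.
Unset Strict Implicit.
Unset Printing Implicit Defensive.

(* A position is the strictly increasing sequence
   [:: a_1; ...; a_k] of its occupied squares. *)

Definition top (p : seq nat) : nat := \max_(x <- p) x.

(* An empty board gets top 0, hence no move. Sorting is the re-indexing of the
   coins after the move. *)
Definition moves (p : seq nat) : seq (seq nat) :=
  [seq sort leq (b :: rem (top p) p) | b <- iota 0 (top p) & b \notin p].

Lemma mex_subproof (s : seq nat) : exists n, n \notin s.
Proof.
exists (\max_(x <- s) x).+1; apply/negP => h.
by have := @leq_bigmax_seq _ s xpredT id _ h isT; rewrite ltnn.
Qed.

Definition mex (s : seq nat) : nat := ex_minn (mex_subproof s).

(* Each move decreases the sum of the squares, so the fuel used in grundy is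
   never exhausted; grundyE below is the defining recursion. *)
Fixpoint grundy_fuel (n : nat) (p : seq nat) : nat :=
  if n is n'.+1 then mex [seq grundy_fuel n' q | q <- moves p] else 0.

Definition grundy (p : seq nat) : nat := grundy_fuel (sumn p).+1 p.

Lemma top_in (p : seq nat) : 0 < top p -> top p \in p.
Proof.
rewrite /top; elim: p => [|x p IHp]; rewrite ?big_nil // big_cons in_cons.
case: (leqP (\max_(y <- p) y) x) => [_|lt_xm] _; first by rewrite eqxx.
by rewrite IHp ?orbT //; apply: leq_ltn_trans lt_xm.
Qed.

Lemma moves_sumn (p q : seq nat) : q \in moves p -> sumn q < sumn p.
Proof.
case/mapP=> b; rewrite mem_filter mem_iota add0n => /andP[_ /= lt_bt] ->.
have tp : top p \in p by apply: top_in; apply: leq_ltn_trans lt_bt.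
rewrite (perm_sumn (permEl (perm_sort _ _))) (perm_sumn (perm_to_rem tp)) /=.
by rewrite ltn_add2r.
Qed.

Lemma moves_sorted (p q : seq nat) :
  sorted ltn p -> q \in moves p -> sorted ltn q.
Proof.
rewrite !ltn_sorted_uniq_leq => /andP[up _] /mapP[b].
rewrite mem_filter => /andP[bp _] ->.
rewrite sort_uniq /= rem_uniq // (sort_sorted leq_total) !andbT.
by apply: contra bp => /mem_rem.
Qed.

Lemma grundyE (p : seq nat) : grundy p = mex [seq grundy q | q <- moves p].
Proof.
have fuelE n m q : sumn q < n -> sumn q < m -> grundy_fuel n q = grundy_fuel m q.
  elim: n m q => [//|n IHn] [//|m] q /= qn qm; congr mex.
  apply/eq_in_map => r /moves_sumn rq.
  by apply: IHn; apply: leq_trans rq _.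
rewrite /grundy [LHS]/=; congr mex; apply/eq_in_map => q /moves_sumn qp.
exact: fuelE.
Qed.

(* Main.v *)
(* A position whose two largest coins c, c+1 are adjacent has value 0 or 1,
   according to the parity of c + k, whatever the other coins are. Hence from a
   position whose top coin has a gap below it, both 0 and 1 are reachable
   (unless the other coins fill an initial segment), by landing the top coin
   just above or just below its predecessor d, or, when d - 1 is occupied,
   anywhere below d - 1. The theorem follows by induction on the sum of the
   squares, by comparing the options of p and of its shift p + 1: an option of p
   whose top two coins are adjacent has value 0 or 1, as does its shift, and
   both values occur among the options of p and of p + 1; any other option has
   the same value as its shift by induction. The only option of p + 1 which is
   not a shift moves a coin to square 0, and a coin in one of the squares
   0, ..., k - 1 never moves again, so that it has the same value as an option
   with that coin on another empty square of this range. *)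

Require Import Defs.
From mathcomp Require Import all_boot.
From mathcomp Require Import zify.

Set Implicit Arguments.
Unset Strict Implicit.
Unset Printing Implicit Defensive.

(** * Mex, and independence of the order of the coins *)

Lemma mex_notin (s : seq nat) : mex s \notin s.
Proof. by rewrite /mex; case: ex_minnP. Qed.

Lemma ltn_mex (s : seq nat) (m : nat) : m < mex s -> m \in s.
Proof.
rewrite /mex; case: ex_minnP => n _ min_n lt_mn.
by apply/negPn/negP => /min_n; rewrite leqNgt lt_mn.
Qed.

Lemma mex_unique (s : seq nat) (n : nat) :
  n \notin s -> (forall m, m < n -> m \in s) -> mex s = n.
Proof.
move=> ns lt_s; case: (ltngtP (mex s) n) => // [/lt_s|/ltn_mex].
  by rewrite (negPf (mex_notin s)).
by rewrite (negPf ns).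
Qed.

Lemma eq_mex (s s' : seq nat) : s =i s' -> mex s = mex s'.
Proof.
move=> ss'; apply: mex_unique => [|m /ltn_mex]; rewrite ss' //.
exact: mex_notin.
Qed.

Lemma perm_top (p q : seq nat) : perm_eq p q -> top p = top q.
Proof. exact: perm_big. Qed.

Lemma perm_moves (p q : seq nat) : perm_eq p q -> moves p = moves q.
Proof.
move=> pq; rewrite /moves (perm_top pq).
rewrite (@eq_filter _ _ (fun b => b \notin q)); last first.
  by move=> b; rewrite (perm_mem pq).
apply: eq_map => b; apply/(perm_sortP leq_total leq_trans anti_leq).
rewrite perm_cons; have [tp|tp] := boolP (top q \in p); last first.
  by rewrite !rem_id // -(perm_mem pq).
rewrite -(perm_cons (top q)) -(permPl (perm_to_rem tp)).
by rewrite -(permPr (perm_to_rem _)) // -(perm_mem pq).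
Qed.

Lemma perm_grundy (p q : seq nat) : perm_eq p q -> grundy p = grundy q.
Proof. by move=> pq; rewrite !grundyE (perm_moves pq). Qed.

Lemma grundy_swap (x y : nat) (S : seq nat) :
  grundy [:: x, y & S] = grundy [:: y, x & S].
Proof. exact/perm_grundy/permEl/(perm_catCA [:: x] [:: y] S). Qed.

Lemma all_ltn_cons (d m : nat) (S : seq nat) :
  d < m -> all (ltn^~ d) S -> all (ltn^~ m) (d :: S).
Proof.
move=> lt_dm /allP ltS; apply/allP => x; rewrite inE => /orP[/eqP->//|/ltS].
by move/ltn_trans; apply.
Qed.

Lemma all_ltn_notin (d m : nat) (S : seq nat) :
  all (ltn^~ d) S -> d <= m -> m \notin S.
Proof. by move=> /allP ltS; apply: contraL => /ltS; rewrite -ltnNge. Qed.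

Lemma grundy_cons (t : nat) (S : seq nat) : all (ltn^~ t) S ->
  grundy (t :: S) = mex [seq grundy (b :: S) | b <- iota 0 t & b \notin S].
Proof.
move=> /allP ltS.
have top_tS : top (t :: S) = t.
  rewrite /top big_cons; apply/maxn_idPl; apply/bigmax_leqP_seq => x /ltS /=.
  by move=> /ltnW.
rewrite grundyE /moves top_tS -map_comp /= eqxx.
rewrite (@eq_in_filter _ _ (fun b => b \notin S)); last first.
  move=> b; rewrite mem_iota add0n /= => lt_bt.
  by rewrite in_cons negb_or neq_ltn lt_bt.
congr mex; apply: eq_map => b /=.
by apply: perm_grundy; rewrite perm_sort.
Qed.

Lemma mem_options (t : nat) (S : seq nat) (v : nat) :
  reflect (exists b, [/\ b < t, b \notin S & grundy (b :: S) = v])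
    (v \in [seq grundy (b :: S) | b <- iota 0 t & b \notin S]).
Proof.
apply: (iffP mapP) => [[b]|[b [lt_bt bS <-]]].
  by rewrite mem_filter mem_iota add0n => /andP[bS lt_bt] ->; exists b.
by exists b; rewrite // mem_filter mem_iota bS.
Qed.

(** * Largest coin and empty squares *)

Lemma perm_max_cons (S : seq nat) : uniq S -> S != [::] ->
  exists d U, [/\ perm_eq S (d :: U), uniq U & all (ltn^~ d) U].
Proof.
move=> uS nS; have topS : top S \in S.
  (* [top_in] leaves out [top] 0, where the head itself is 0. *)
  case: S nS {uS} => [//|x S] _; case: (posnP (top (x :: S))); last exact: top_in.
  rewrite /top big_cons => /eqP top0; rewrite (eqP top0).
  by move: top0; rewrite -leqn0 geq_max leqn0 => /andP[/eqP-> _]; rewrite mem_head.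
exists (top S), (rem (top S) S); split; rewrite ?perm_to_rem ?rem_uniq //.
apply/allP => x; rewrite mem_rem_uniq // inE => /andP[xt xS].
rewrite /= ltn_neqAle xt; exact: (@leq_bigmax_seq _ S xpredT id).
Qed.

Lemma size_bounded (n : nat) (S : seq nat) :
  uniq S -> all (ltn^~ n) S -> size S <= n.
Proof.
move=> uS /allP ltS; rewrite -[n](size_iota 0); apply: uniq_leq_size => // x.
by move/ltS; rewrite mem_iota.
Qed.

Lemma bounded_full (n : nat) (S : seq nat) :
  uniq S -> all (ltn^~ n) S -> size S = n -> S =i iota 0 n.
Proof.
move=> uS /allP ltS szS; have sub x : x \in S -> x \in iota 0 n by move/ltS; rewrite mem_iota.
by have [|_] := uniq_min_size uS sub; first by rewrite size_iota szS.
Qed.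

Lemma ex_empty_square (n : nat) (S : seq nat) :
  size S < n -> exists2 b, b < n & b \notin S.
Proof.
move=> ltn; case: (boolP (all (mem S) (iota 0 n))) => [/allP sub|].
  have := uniq_leq_size (iota_uniq 0 n) sub.
  by rewrite size_iota leqNgt ltn.
by case/allPn => b; rewrite mem_iota => lt_b bS; exists b.
Qed.

(** Supplies the landing square that creates the pair [c.-1], [c]: either [c.-1] itself or, if that
    is occupied, any empty square below. *)
Lemma ex_square_pred (c : nat) (T : seq nat) :
  uniq T -> all (ltn^~ c) T -> size T < c ->
  exists b T', [/\ b < c, b \notin T, perm_eq (b :: T) (c.-1 :: T'),
    uniq T' & all (ltn^~ c.-1) T'].
Proof.
move=> uT ltT szT.
have [b [lt_bc bT cbT]] : exists b, [/\ b < c, b \notin T & c.-1 \in b :: T].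
  have [cT|cT] := boolP (c.-1 \in T); last first.
    by exists c.-1; rewrite mem_head; split=> //; lia.
  by have [b] := ex_empty_square szT; exists b; rewrite inE cT orbT.
exists b, (rem c.-1 (b :: T)).
have ubT : uniq (b :: T) by rewrite /= bT.
split=> //; [exact: perm_to_rem | exact: rem_uniq|].
apply/allP => x; rewrite mem_rem_uniq // !inE => /andP[/eqP xc].
by case/orP => [/eqP xb|/(allP ltT)] /=; lia.
Qed.

(** The coins of [S] fill an initial segment and are stuck, so the coin [t] is a Nim heap of size
    [t - n]. *)
Lemma grundy_full (n t : nat) (S : seq nat) :
  uniq S -> all (ltn^~ n) S -> size S = n -> n <= t -> grundy (t :: S) = t - n.
Proof.
move=> uS ltS szS; have fullS := bounded_full uS ltS szS.
elim/ltn_ind: t => t IH le_nt; rewrite grundy_cons; last first.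
  by apply/allP => x /(allP ltS) /=; lia.
apply: mex_unique => [|m lt_m].
  apply/mem_options => -[b [lt_bt]].
  rewrite fullS mem_iota add0n /= -leqNgt => le_nb; rewrite IH //; lia.
apply/mem_options; exists (m + n); split; rewrite ?fullS ?mem_iota ?IH; lia.
Qed.

(* With k = size T + 2 coins, this parity is that of c + k. *)
Definition pair_value (c : nat) : Prop := forall T : seq nat,
  uniq T -> all (ltn^~ c) T -> grundy [:: c.+1, c & T] = odd (c + size T).

(** The pairs [d.+1], [d] and [d], [d.-1] have opposite parities, the number of coins being the
    same. The values of pairs are hypotheses so that the lemma can serve inside the induction of
    [grundy_pair]. *)
Lemma gap_options (t d : nat) (U : seq nat) :
  pair_value d -> pair_value d.-1 ->
  uniq U -> all (ltn^~ d) U -> d.+1 < t -> size U < d ->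
  forall e : bool, exists b,
    [/\ b < t, b \notin d :: U & grundy (b :: d :: U) = e].
Proof.
move=> pvd pvd1 uU ltU lt_dt szU e.
have [ee|ee] := eqVneq (odd (d + size U)) e.
  exists d.+1; rewrite pvd // ee inE negb_or (all_ltn_notin ltU (leqnSn d)).
  by rewrite andbT eqn_leq ltnn.
have [b [T' [lt_bd bU pbU uT' ltT']]] := ex_square_pred uU ltU szU.
have d_gt0 : 0 < d by apply: leq_trans lt_bd.
exists b; rewrite inE negb_or bU andbT (ltn_eqF lt_bd); split=> //.
  exact: ltn_trans lt_bd (ltnW lt_dt).
rewrite grundy_swap (@perm_grundy _ [:: d.-1.+1, d.-1 & T']).
  have [szT'] := perm_size pbU; rewrite pvd1 // -szT'; congr nat_of_bool.
  by move: ee; rewrite -{1}(prednK d_gt0) addSn /=; case: e; case: odd.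
by rewrite prednK // perm_cons.
Qed.

Lemma grundy_pair (c : nat) : pair_value c.
Proof.
elim/ltn_ind: c => c IH T uT ltT.
have szT := size_bounded uT ltT.
have cT : c \notin T := all_ltn_notin ltT (leqnn c).
have ltcT : all (ltn^~ c.+1) (c :: T) by apply: all_ltn_cons.
(* If [T] fills all squares below [c], there is no move and [c + size T] is even. *)
have [szc|nsz] := eqVneq (size T) c.
  rewrite (grundy_full _ ltcT) /= ?cT ?szc // subnn.
  by rewrite addnn odd_double.
rewrite grundy_cons //; apply: mex_unique => [|m lt_m].
  apply/mem_options => -[b [lt_bc]]; rewrite inE negb_or => /andP[bc bT].
  have ubT : uniq (b :: T) by rewrite /= bT.
  have [d [U [pdU uU ltU]]] := perm_max_cons ubT isT.
  have szU : size U = size T by case: (perm_size pdU).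
  have lt_dc : d < c.
    have : d \in b :: T by rewrite (perm_mem pdU) mem_head.
    rewrite inE => /orP[/eqP->|/(allP ltT)] //.
    by rewrite ltn_neqAle bc -ltnS.
  have -> : grundy [:: b, c & T] = grundy [:: c, d & U].
    by rewrite grundy_swap; apply: perm_grundy; rewrite perm_cons.
  have ltdU m : d < m -> all (ltn^~ m) (d :: U).
    by move=> dm; apply: all_ltn_cons.
  (* No option has the claimed value: an adjacent top pair has the opposite parity. *)
  have [cd|ncd] := eqVneq c d.+1.
    rewrite cd IH // szU addSn /=.
    by case: odd.
  have udU : uniq (d :: U) by rewrite -(perm_uniq pdU).
  (* Here the Nim heap [c - d.+1] again has parity opposite to [c + size T]. *)
  have [szd|nszd] := eqVneq (size U) d.
    rewrite (grundy_full udU (ltdU d.+1 _)) /= ?szd //.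
    by rewrite -szU szd; move: lt_dc ncd; clear; lia.
  have lt_szU : size U < d by rewrite ltn_neqAle nszd size_bounded.
  have gap : d.+1 < c by rewrite ltn_neqAle eq_sym ncd.
  (* Both 0 and 1 are options across the gap, so the mex is neither. *)
  rewrite grundy_cons ?ltdU // => mexE.
  have /mem_options := mex_notin [seq grundy (b0 :: d :: U) | b0 <- iota 0 c & b0 \notin d :: U].
  rewrite mexE; apply.
  by apply: gap_options => //; apply: IH => //; apply: leq_ltn_trans lt_dc; apply: leq_pred.
(* Now [m] is 0 and [c + size T] is odd; creating the pair [c.-1], [c] reaches value 0. *)
have lt_szc : size T < c by rewrite ltn_neqAle nsz.
have [b [T' [lt_bc bT pbT uT' ltT']]] := ex_square_pred uT ltT lt_szc.
have c_gt0 : 0 < c by apply: leq_trans lt_bc.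
apply/mem_options; exists b; rewrite inE negb_or bT andbT (ltn_eqF lt_bc).
split=> //; first exact: ltnW.
rewrite grundy_swap (@perm_grundy _ [:: c.-1.+1, c.-1 & T']); last first.
  by rewrite prednK // perm_cons.
have [szT'] := perm_size pbT; rewrite IH ?ltn_predL // -szT'.
by move: lt_m; rewrite -{1}(prednK c_gt0) addSn /=; case: odd; case: m.
Qed.

(** * Stuck coins and shifted positions *)

Lemma grundy_exchange (x y : nat) (P : seq nat) :
  uniq P -> x \notin P -> y \notin P -> x <= size P -> y <= size P ->
  grundy (x :: P) = grundy (y :: P).
Proof.
have [n] := ubnP (sumn P); elim: n x y P => // n IH x y P ltPn uP.
have [->//|neq_xy] := eqVneq x y => xP yP le_x le_y.
have nP : P != [::] by apply: contraNneq neq_xy => P0; move: le_x le_y; rewrite P0 /=; lia.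
have [t [U [ptU uU ltU]]] := perm_max_cons uP nP.
have szU : size P = (size U).+1 by rewrite (perm_size ptU).
have sumP : sumn P = t + sumn U by rewrite (perm_sumn ptU).
(* Otherwise [x], [y] and [P] would be [size P + 2] distinct squares among [0, ..., size P]. So [t]
   is the coin to move in both positions. *)
have lt_Pt : size P < t.
  rewrite ltnNge; apply/negP => le_t.
  suff : size [:: x, y & P] <= (size P).+1 by rewrite ltnn.
  apply: size_bounded; first by rewrite /= inE negb_or neq_xy xP yP.
  apply/allP => z; rewrite !inE (perm_mem ptU) inE.
  case/or4P => [/eqP->|/eqP->|/eqP->|/(allP ltU) lt_zt] //.
  exact: ltn_trans lt_zt _.
have top_t z : z <= size P ->
    grundy (z :: P) = mex [seq grundy (b :: z :: U) | b <- iota 0 t & b \notin z :: U].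
  move=> le_z; rewrite -grundy_cons; last by rewrite /= ltU andbT; apply: leq_ltn_trans lt_Pt.
  by rewrite grundy_swap; apply: perm_grundy; rewrite perm_cons.
have notU z : z \notin P -> z \notin U.
  by rewrite (perm_mem ptU) inE negb_or => /andP[].
have incl u v w : u != v -> u \notin P -> v \notin P -> u <= size P -> v <= size P ->
  w \in [seq grundy (b :: u :: U) | b <- iota 0 t & b \notin u :: U] ->
  w \in [seq grundy (b :: v :: U) | b <- iota 0 t & b \notin v :: U].
  move=> uv uP' vP' le_u le_v /mem_options[b [lt_bt]].
  rewrite inE negb_or => /andP[bu bU] <-; apply/mem_options.
  (* Landing on [v] beside [u] gives the same position as landing on [u] beside [v]; any other
     landing square is kept, and induction applies. *)
  have [->|bv] := eqVneq b v.
    exists u; rewrite inE negb_or uv notU //; split=> //.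
      exact: leq_ltn_trans le_u lt_Pt.
    exact: grundy_swap.
  exists b; rewrite inE negb_or bv bU; split=> //.
  rewrite (grundy_swap b v) (grundy_swap b u).
  apply: IH; rewrite /= ?inE ?negb_or ?(notU _ uP') ?(notU _ vP') ?bU ?(eq_sym u) ?(eq_sym v) ?bu ?bv -?szU //.
  by move: ltPn lt_bt; rewrite sumP; clear; lia.
rewrite !top_t //; apply: eq_mex => w; apply/idP/idP; apply: incl => //.
by rewrite eq_sym.
Qed.

(** The pair [c], [c.+1] passes to every option whose two largest coins are not adjacent, so the
    hypotheses are inherited. The bound on [size S] ensures an empty square below the largest coin
    of [S]. *)
Lemma grundy_shift (t c : nat) (S : seq nat) :
  uniq S -> all (ltn^~ t) S -> t.-1 \notin S ->
  c \in S -> c.+1 \in S -> size S <= c.+1 ->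
  grundy (t.+1 :: map succn S) = grundy (t :: S).
Proof.
have [n] := ubnP (t + sumn S); elim: n t S => // n IH t S lt_n uS ltS tS cS cS1 szS.
have nS : S != [::] by case: (S) cS.
have all_succ d U : all (ltn^~ d) U -> all (ltn^~ d.+1) (map succn U).
  by rewrite all_map.
have uniq_succ U : uniq U -> uniq (map succn U) by rewrite (map_inj_uniq succn_inj).
have notin_succ b U : (b.+1 \notin map succn U) = (b \notin U).
  by rewrite (mem_map succn_inj).
have option_shift b : b < t -> b \notin S ->
    grundy (b.+1 :: map succn S) = grundy (b :: S)
    \/ exists e e' : bool, grundy (b.+1 :: map succn S) = e /\ grundy (b :: S) = e'.
  move=> lt_bt bS; have ubS : uniq (b :: S) by rewrite /= bS.
  have [d [U [pdU uU ltU]]] := perm_max_cons ubS isT.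
  have pdU1 : perm_eq (b.+1 :: map succn S) (d.+1 :: map succn U).
    exact: (perm_map succn pdU).
  rewrite (perm_grundy pdU) (perm_grundy pdU1).
  have [dU|dU] := boolP (d.-1 \in U); [right | left].
    have d_gt0 : 0 < d by apply: leq_trans (allP ltU _ dU).
    have := perm_to_rem dU; set T := rem _ U => pT.
    have uT : uniq T by apply: rem_uniq.
    have ltT : all (ltn^~ d.-1) T.
      apply/allP => x; rewrite mem_rem_uniq // inE => /andP[xd /(allP ltU)] /=.
      by move=> lt_xd; rewrite ltn_neqAle xd -ltnS prednK.
    exists (odd (d + size T)), (odd (d.-1 + size T)); split.
      rewrite (@perm_grundy _ [:: d.+1, d & map succn T]).
        rewrite grundy_pair ?size_map ?uniq_succ //.
        by have := all_succ _ _ ltT; rewrite prednK.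
      rewrite perm_cons; have := perm_map succn pT.
      by rewrite /= prednK.
    rewrite (@perm_grundy _ [:: d.-1.+1, d.-1 & T]); first exact: grundy_pair.
    by rewrite prednK // perm_cons.
  have memU x : x \in S -> x != d -> x \in U.
    move=> xS /negPf xd; have : x \in b :: S by rewrite inE xS orbT.
    by rewrite (perm_mem pdU) inE xd.
  have le_d x : x \in S -> x <= d.
    move=> xS; have : x \in b :: S by rewrite inE xS orbT.
    by rewrite (perm_mem pdU) inE => /orP[/eqP->|/(allP ltU)/ltnW].
  have cU : c \in U by apply: memU => //; rewrite neq_ltn le_d.
  apply: IH => //.
  - have := perm_sumn pdU; rewrite /= => <-.
    by apply: leq_trans (_ : b + sumn S < t + sumn S) lt_n; rewrite ltn_add2r.
  (* If [c.+1] were the new top [d], then [d.-1 = c] would lie in [U]. *)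
  - by apply: memU => //; apply: contraNneq dU => <-.
  - by have [<-] := perm_size pdU.
have [d [U [pdU uU ltU]]] := perm_max_cons uS nS.
have dS : d \in S by rewrite (perm_mem pdU) mem_head.
have lt_dt : d.+1 < t.
  have : d != t.-1 by apply: contraNneq tS => <-.
  by have := allP ltS _ dS => /=; clear; lia.
have lt_cd : c < d.
  by have := cS1; rewrite (perm_mem pdU) inE => /orP[/eqP<-//|/(allP ltU)/ltnW].
have szU : size S = (size U).+1 by rewrite (perm_size pdU).
have lt_Ud : size U < d by apply: leq_trans lt_cd; rewrite -szU.
have low (e : bool) : nat_of_bool e \in [seq grundy (b :: S) | b <- iota 0 t & b \notin S].
  apply/mem_options.
  have [b [lt_bt bdU <-]] := gap_options (@grundy_pair _) (@grundy_pair _) uU ltU lt_dt lt_Ud e.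
  exists b; rewrite (perm_mem pdU) bdU; split=> //.
  by apply: perm_grundy; rewrite perm_cons.
have low1 (e : bool) : nat_of_bool e \in
    [seq grundy (b :: map succn S) | b <- iota 0 t.+1 & b \notin map succn S].
  apply/mem_options.
  have lt_Ud1 : size (map succn U) < d.+1 by rewrite size_map ltnW.
  have [b [lt_bt bdU <-]] := gap_options (t := t.+1) (@grundy_pair _)
    (@grundy_pair _) (uniq_succ _ uU) (all_succ _ _ ltU) lt_dt lt_Ud1 e.
  exists b; rewrite (perm_mem (perm_map succn pdU)) bdU; split=> //.
  by apply: perm_grundy; rewrite perm_cons (perm_map succn pdU).
rewrite !grundy_cons ?all_succ //; apply: eq_mex => v.
apply/idP/idP => /mem_options[b [lt_bt bS <-]].
  (* A move to 0 is exchanged for a move to some empty [x.+1 <= size S], which is the shift of a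
     move. *)
  have [b' [lt_b't b'S ->]] : exists b', [/\ b' < t, b' \notin S &
      grundy (b :: map succn S) = grundy (b'.+1 :: map succn S)].
    case: b lt_bt bS => [|b] lt_bt bS; last by exists b; rewrite -notin_succ.
    have [x lt_x xS] : exists2 x, x < size S & x \notin S.
      have [|x lt_x xU] := @ex_empty_square (size S) U; first by rewrite szU.
      exists x => //; rewrite (perm_mem pdU) inE negb_or xU andbT neq_ltn.
      by rewrite (leq_trans lt_x) // szU.
    exists x; split=> //; first apply: leq_trans lt_x _.
      by rewrite szU; apply: leq_trans lt_Ud _; do 2 apply: ltnW.
    by apply: grundy_exchange; rewrite ?notin_succ ?uniq_succ ?size_map.
  have [->|[e [e' [-> _]]]] := option_shift b' lt_b't b'S; last exact: low.
  by apply/mem_options; exists b'.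
have [<-|[e [e' [_ ->]]]] := option_shift b lt_bt bS; last exact: low1.
by apply/mem_options; exists b.+1; rewrite notin_succ.
Qed.

Theorem theorem6 (k : nat) (a : nat -> nat) (k_ge3 : 3 <= k)
  (a_incr : forall i : nat, 1 <= i -> i < k -> a i < a (i + 1))
  (a_gap : a k > a (k - 1) + 1)
  (a_adj : exists i : nat,
     [/\ 1 <= i, i <= k - 2, a i >= k - 2 & a i + 1 = a (i + 1)]) :
  grundy [seq a j + 1 | j <- iota 1 k] = grundy [seq a j | j <- iota 1 k].
Proof.
have a_mono i j : 1 <= i -> i < j -> j <= k -> a i < a j.
  move=> i_gt0; elim: j => // j IH lt_ij le_jk.
  have := a_incr j; rewrite addn1 => /(_ ltac:(lia) le_jk).
  have [->//|ne_ij] := eqVneq i j; have := IH ltac:(lia) ltac:(lia); lia.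
set S := [seq a j | j <- iota 1 k.-1].
have memS j : 1 <= j -> j < k -> a j \in S.
  by move=> j_gt0 lt_jk; apply: map_f; rewrite mem_iota; lia.
(* This form of the gap yields both that [a k] is the top coin and that [(a k).-1] is empty. *)
have ltS x : x \in S -> x < (a k).-1.
  case/mapP => j; rewrite mem_iota => /andP[j_gt0 lt_j] ->.
  have [->|ne_j] := eqVneq j (k - 1); first by lia.
  by have := a_mono j (k - 1) j_gt0; lia.
have perm_k (f : nat -> nat) :
    perm_eq [seq f j | j <- iota 1 k] (f k :: [seq f j | j <- iota 1 k.-1]).
  have -> : iota 1 k = rcons (iota 1 k.-1) k.
    by case: (k) k_ge3 => // n _; rewrite -[n.+1 in LHS]addn1 iotaD cats1 add1n.
  by rewrite map_rcons perm_rcons.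
rewrite !(perm_grundy (perm_k _)) addn1.
have -> : [seq a j + 1 | j <- iota 1 k.-1] = map succn S.
  by rewrite -map_comp; apply: eq_map => j; rewrite /= addn1.
case: a_adj => i [i_gt0 le_ik le_a adj].
(* With [size S = k - 1], the bound [size S <= c.+1] at [c = a i] is the assumption
   [a i >= k - 2]. *)
apply: (@grundy_shift _ (a i)).
- rewrite map_inj_in_uniq ?iota_uniq // => j1 j2; rewrite !mem_iota => h1 h2 eq_a.
  case: (ltngtP j1 j2) => // [lt_j|lt_j].
    by have := a_mono j1 j2; lia.
  by have := a_mono j2 j1; lia.
- by apply/allP => x /ltS /=; lia.
- by apply/negP => /ltS; rewrite ltnn.
- by apply: memS; lia.
- by rewrite -[(a i).+1]addn1 adj; apply: memS; lia.
- by rewrite size_map size_iota; lia.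
Qed.
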